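(* Let $\varepsilon>0$ be fixed, let $(y,z)$ be the exact solution of $y'=z$, $z'=\frac{1}{\varepsilon}g(y,z)$, and let $y^{[k]},z^{[k]}$ denote the iterates of the semi-implicit two-derivative predictor-corrector method described in the context, for one step of size $\Delta t$ from $t^n$ to $t^{n+1}=t^n+\Delta t$, started from exact data $y^n=y(t^n)$, $z^n=z(t^n)$. Define $\delta^{[k]}:=\left\|\left(y^{[k]}-y(t^{n+1}),\,z^{[k]}-z(t^{n+1})\right)\right\|$. Then for every integer $k\ge 0$, $$\delta^{[k]}=\mathcal{O}\left(\Delta t^{\min\{4,\,2+k\}+1}\right)\qquad(\Delta t\to 0),$$ where the constants in $\mathcal{O}$ may depend on $\varepsilon$. Consequently, when $k_{\max}\ge 2$, the method is fourth-order consistent, i.e. its one-step (local) error starting from exact data is $\mathcal{O}(\Delta t^{5})$.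
   Context: Setting: $g:\mathbb{R}^2\to\mathbb{R}$ is smooth, $\varepsilon>0$, and the scalar functions $y,z$ solve $y'(t)=z(t)$, $z'(t)=\frac{1}{\varepsilon}g(y(t),z(t))$ for $0\le t\le T$, with $y(0)=y^0$, $z(0)=z^0$. Define $\nabla g=(\partial_y g,\partial_z g)$ and $$\dot g(y,z):=\nabla g(y,z)\cdot\begin{pmatrix} z\\ \frac{1}{\varepsilon}g(y,z)\end{pmatrix}=\partial_y g(y,z)\,z+\tfrac1\varepsilon\partial_z g(y,z)\,g(y,z).$$ Standing assumptions: there is a constant $c>0$ with $\partial_z g(y,z)<-c$ for all $y,z\in\mathbb{R}$; and $g,\dot g$ are Lipschitz: there are constants $L_g,L_{\dot g}$ independent of $\varepsilon$ with $|g(y_1,z_1)-g(y_2,z_2)|\le L_g\|(y_1-y_2,z_1-z_2)\|$ and $|\dot g(y_1,z_1)-\dot g(y_2,z_2)|\le \frac{L_{\dot g}}{\varepsilon}\|(y_1-y_2,z_1-z_2)\|$. Method (one step from $(y^n,z^n)$ at $t^n$ to $(y^{n+1},z^{n+1})$ at $t^{n+1}=t^n+\Delta t$). Write $g^n=g(y^n,z^n)$, $\dot g^n=\dot g(y^n,z^n)$, $g^{[k]}=g(y^{[k]},z^{[k]})$, $\dot g^{[k]}=\dot g(y^{[k]},z^{[k]})$. Predict: $y^{[0]}=y^n+\Delta t\,z^n+\frac{\Delta t^2}{2\varepsilon}g^n$, and $z^{[0]}$ solves $z^{[0]}=z^n+\frac{\Delta t}{\varepsilon}g^{[0]}-\frac{\Delta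 t^2}{2\varepsilon}\dot g^{[0]}$. Correct: for $0\le k\le k_{\max}-1$, $$y^{[k+1]}=y^n+\tfrac{\Delta t}{2}(z^n+z^{[k]})+\tfrac{\Delta t^2}{12\varepsilon}(g^n-g^{[k]}),$$ and $z^{[k+1]}$ solves $$z^{[k+1]}=z^n+\tfrac{\Delta t}{\varepsilon}(g^{[k+1]}-g^{[k]})-\tfrac{\Delta t^2}{2\varepsilon}(\dot g^{[k+1]}-\dot g^{[k]})+\tfrac{\Delta t}{2\varepsilon}(g^n+g^{[k]})+\tfrac{\Delta t^2}{12\varepsilon}(\dot g^n-\dot g^{[k]}).$$ Update: $y^{n+1}=y^{[k_{\max}]}$, $z^{n+1}=z^{[k_{\max}]}$. *)

(* Defs.v *)
From Stdlib Require Import Reals.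
From Coquelicot Require Import Coquelicot.
Open Scope R_scope.

(* [ex_diff_n g n y z] says that all partial derivatives of [g] up to order [n]
   exist and are continuous (in both variables jointly) at [(y, z)]. *)
Definition smooth2 (g : R -> R -> R) : Prop :=
  forall (n : nat) (y z : R), ex_diff_n g n y z.

Definition dy (g : R -> R -> R) (y z : R) : R := Derive (fun u => g u z) y.

Definition dz (g : R -> R -> R) (y z : R) : R := Derive (fun v => g y v) z.

Definition gdot (g : R -> R -> R) (eps y z : R) : R :=
  dy g y z * z + / eps * dz g y z * g y z.

(* On pairs, Coquelicot's [norm] is the Euclidean norm sqrt (a^2 + b^2). *)
Definition lipschitz2 (f : R -> R -> R) (L : R) : Prop :=
  forall y1 z1 y2 z2 : R,
    Rabs (f y1 z1 - f y2 z2) <= L * norm (y1 - y2, z1 - z2).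

(* Derivative relative to [D]: this is [is_derive] with [locally t] replaced by
   its trace on [D], hence a one-sided derivative at the end points when [D] is
   a nontrivial closed interval. *)
Definition is_derive_within (D : R -> Prop) (f : R -> R) (t l : R) : Prop :=
  filterdiff f (within D (locally t)) (fun h => scal h l).

Definition exact_solution (g : R -> R -> R) (eps T y0 z0 : R) (y z : R -> R)
  : Prop :=
  y 0 = y0 /\ z 0 = z0 /\
  forall t : R, 0 <= t <= T ->
    is_derive_within (fun s => 0 <= s <= T) y t (z t) /\
    is_derive_within (fun s => 0 <= s <= T) z t (/ eps * g (y t) (z t)).

Definition predictor (g : R -> R -> R) (eps dt yn zn yk zk : R) : Prop :=
  yk = yn + dt * zn + dt ^ 2 / (2 * eps) * g yn zn /\
  zk = zn + dt / eps * g yk zk - dt ^ 2 / (2 * eps) * gdot g eps yk zk.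

(* [(yk, zk)] is the current iterate and [(yk1, zk1)] the next one; the second
   equation is implicit in [zk1]. *)
Definition corrector (g : R -> R -> R) (eps dt yn zn yk zk yk1 zk1 : R)
  : Prop :=
  yk1 = yn + dt / 2 * (zn + zk) + dt ^ 2 / (12 * eps) * (g yn zn - g yk zk) /\
  zk1 = zn
        + dt / eps * (g yk1 zk1 - g yk zk)
        - dt ^ 2 / (2 * eps) * (gdot g eps yk1 zk1 - gdot g eps yk zk)
        + dt / (2 * eps) * (g yn zn + g yk zk)
        + dt ^ 2 / (12 * eps) * (gdot g eps yn zn - gdot g eps yk zk).

(* Only the entries [0 .. kmax] of the sequences [Y], [Z] are constrained. *)
Definition iterates (g : R -> R -> R) (eps dt yn zn : R) (kmax : nat)
    (Y Z : nat -> R) : Prop :=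
  predictor g eps dt yn zn (Y 0%nat) (Z 0%nat) /\
  forall k : nat, (k < kmax)%nat ->
    corrector g eps dt yn zn (Y k) (Z k) (Y (S k)) (Z (S k)).

(* The method as a relation between the old and the new values, since the
   stages are given by implicit equations. *)
Definition method_step (g : R -> R -> R) (eps : R) (kmax : nat)
    (dt yn zn yn1 zn1 : R) : Prop :=
  exists Y Z : nat -> R,
    iterates g eps dt yn zn kmax Y Z /\ yn1 = Y kmax /\ zn1 = Z kmax.

Definition error_at (y z : R -> R) (t yk zk : R) : R :=
  norm (yk - y t, zk - z t).

(* [step dt yn zn yn1 zn1] has local error O(dt^(p+1)) as dt -> 0+ when started
   from exact data at any time [tn], uniformly in [tn]. *)
Definition consistent_of_order (step : R -> R -> R -> R -> R -> Prop)
    (T : R) (y z : R -> R) (p : nat) : Prop :=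
  exists C dt0 : R, 0 < dt0 /\
    forall dt tn yn1 zn1 : R,
      0 < dt < dt0 -> 0 <= tn -> tn + dt <= T ->
      step dt (y tn) (z tn) yn1 zn1 ->
      error_at y z (tn + dt) yn1 zn1 <= C * dt ^ (p + 1).

(* Main.v *)
Require Import Defs.
From Stdlib Require Import Reals Lra Lia.
From Coquelicot Require Import Coquelicot.
Open Scope R_scope.

(* The exact solution satisfies the relations obtained from the predictor and
   the corrector by replacing the iterates with exact values, up to a Taylor
   remainder O(dt^3) (resp. a two-point Hermite quadrature remainder O(dt^5)).
   Subtracting and using that [g] and [gdot] are Lipschitz, the implicit terms
   contribute at most half of the new error once dt is small compared with eps,
   whence d_0 <= K dt^3 and d_(k+1) <= K (dt d_k + dt^5). *)

(** * Derivatives on an interval of globally continuous functions *)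

(* Continuity is demanded on all of R, beyond the interval, so that no one-sided
   notion is needed at the end points; trajectories are clamped to fit this. *)
Definition deriv_on (a b : R) (f f' : R -> R) : Prop :=
  (forall t, continuous f t) /\ (forall t, a < t < b -> is_derive f t (f' t)).

Lemma deriv_on_const (a b k : R) : deriv_on a b (fun _ => k) (fun _ => 0).
Proof.
  split; intros t; [apply continuous_const|intros _; apply (is_derive_const k t)].
Qed.

Lemma deriv_on_id (a b : R) : deriv_on a b (fun t => t) (fun _ => 1).
Proof.
  split; intros t; [apply continuous_id|intros _; apply (is_derive_id t)].
Qed.

Lemma deriv_on_plus (a b : R) (f f' h h' : R -> R) :
  deriv_on a b f f' -> deriv_on a b h h' ->
  deriv_on a b (fun t => f t + h t) (fun t => f' t + h' t).
Proof.
  intros [Cf Df] [Ch Dh]; split.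
  - intros t; apply (continuous_plus f h); auto.
  - intros t Ht; apply (is_derive_plus f h); auto.
Qed.

Lemma deriv_on_mult (a b : R) (f f' h h' : R -> R) :
  deriv_on a b f f' -> deriv_on a b h h' ->
  deriv_on a b (fun t => f t * h t) (fun t => f' t * h t + f t * h' t).
Proof.
  intros [Cf Df] [Ch Dh]; split.
  - intros t; apply (continuous_mult f h); auto.
  - intros t Ht; apply (is_derive_mult f h); auto using Rmult_comm.
Qed.

Lemma deriv_on_ext (a b : R) (f f1 f' f1' : R -> R) :
  (forall t, f t = f1 t) -> (forall t, f' t = f1' t) ->
  deriv_on a b f f' -> deriv_on a b f1 f1'.
Proof.
  intros E E' [Cf Df]; split.
  - intros t; apply (continuous_ext f); auto.
  - intros t Ht; rewrite <- E'; apply (is_derive_ext f); auto.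
Qed.

Lemma deriv_on_sub (a b a1 b1 : R) (f f' : R -> R) :
  a <= a1 -> b1 <= b -> deriv_on a b f f' -> deriv_on a1 b1 f f'.
Proof.
  intros Ha Hb [Cf Df]; split; [exact Cf|intros t Ht; apply Df; lra].
Qed.

Lemma deriv_on_minus (a b : R) (f f' h h' : R -> R) :
  deriv_on a b f f' -> deriv_on a b h h' ->
  deriv_on a b (fun t => f t - h t) (fun t => f' t - h' t).
Proof.
  intros [Cf Df] [Ch Dh]; split.
  - intros t; apply (continuous_minus f h); auto.
  - intros t Ht; apply (is_derive_minus f h); auto.
Qed.

(** The mean value theorem replaces integration: [f t] equals [f' x * (t - a)] with [x] between [a]
    and [t]. The factor [1 / (n + 1)] is given up, so the same constant survives repeated use. *)
Lemma deriv_on_pow_bound (a b K : R) (n : nat) (f f' : R -> R) :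
  0 <= K -> deriv_on a b f f' -> f a = 0 ->
  (forall t, a <= t <= b -> Rabs (f' t) <= K * (t - a) ^ n) ->
  forall t, a <= t <= b -> Rabs (f t) <= K * (t - a) ^ S n.
Proof.
  intros HK [Cf Df] Ha Hb t Ht.
  destruct (Req_dec t a) as [->|Hne].
  { rewrite Ha, Rabs_R0, Rminus_diag; simpl; lra. }
  destruct (MVT_gen f a t f') as [x [Hx E]].
  - rewrite Rmin_left, Rmax_right by lra; intros x Hx; apply Df; lra.
  - intros x _; apply continuity_pt_filterlim, Cf.
  - rewrite Rmin_left, Rmax_right in Hx by lra.
    rewrite Ha, Rminus_0_r in E; rewrite E, Rabs_mult, (Rabs_pos_eq (t - a)) by lra.
    replace (K * (t - a) ^ S n) with (K * (t - a) ^ n * (t - a)) by (simpl; ring).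
    apply Rmult_le_compat_r; [lra|].
    apply Rle_trans with (K * (x - a) ^ n); [apply Hb; lra|].
    apply Rmult_le_compat_l; [lra|apply pow_incr; lra].
Qed.


Lemma deriv_on_sq (a b : R) (f f' : R -> R) :
  deriv_on a b f f' -> deriv_on a b (fun t => f t ^ 2) (fun t => 2 * f t * f' t).
Proof.
  intros D.
  apply (deriv_on_ext a b (fun t => f t * f t) _ (fun t => f' t * f t + f t * f' t));
    [intros t; ring | intros t; ring | apply deriv_on_mult; exact D].
Qed.

Lemma deriv_on_div (a b k : R) (f f' : R -> R) :
  deriv_on a b f f' -> deriv_on a b (fun t => f t / k) (fun t => f' t / k).
Proof.
  intros D.
  apply (deriv_on_ext a b (fun t => f t * / k) _ (fun t => f' t * / k + f t * 0));
    [intros t; reflexivity | intros t; unfold Rdiv; ring |].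
  apply deriv_on_mult; [exact D | apply deriv_on_const].
Qed.

(** The constant rule comes first, so that subterms free of the variable, such as [f a], are not
    decomposed. *)
Ltac deriv_on_step :=
  lazymatch goal with
  | |- deriv_on ?a ?b (fun _ => ?k) _ => apply deriv_on_const
  | |- deriv_on ?a ?b (fun t => t) _ => apply deriv_on_id
  | |- deriv_on ?a ?b (fun t => @?f t + @?h t) _ => eapply (deriv_on_plus a b f _ h _)
  | |- deriv_on ?a ?b (fun t => @?f t - @?h t) _ => eapply (deriv_on_minus a b f _ h _)
  | |- deriv_on ?a ?b (fun t => @?f t * @?h t) _ => eapply (deriv_on_mult a b f _ h _)
  | |- deriv_on ?a ?b (fun t => @?f t / ?k) _ => eapply (deriv_on_div a b k f _)
  | |- deriv_on ?a ?b (fun t => @?f t ^ 2) _ => eapply (deriv_on_sq a b f _)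
  | H : deriv_on ?a ?b ?f _ |- deriv_on ?a ?b (fun t => ?f t) _ => eapply H
  end.

(** The structural rules build a derivative into an existential variable; only then does [field]
    identify it with the claimed one. *)
Ltac deriv_on_tac :=
  match goal with |- deriv_on ?a ?b ?f ?f' =>
    eapply (deriv_on_ext a b f f _ f'); [reflexivity| |repeat deriv_on_step];
    intros t; cbv beta; field
  end.

(** * Taylor and Hermite remainders *)

(* In this and the next two lemmas the error, as a function of the right end
   point, is differentiated until only the top derivative is left; it vanishes
   at [a] together with all the intermediate derivatives. *)
Lemma taylor_forward (a b M : R) (F f f1 f2 : R -> R) :
  a <= b -> deriv_on a b F f -> deriv_on a b f f1 -> deriv_on a b f1 f2 ->
  (forall t, a <= t <= b -> Rabs (f2 t) <= M) ->
  Rabs (F b - F a - (b - a) * f a - (b - a) ^ 2 / 2 * f1 a) <= M * (b - a) ^ 3.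
Proof.
  intros Hab D0 D1 D2 HM.
  assert (HM0 : 0 <= M) by (eapply Rle_trans; [apply Rabs_pos|apply (HM a); lra]).
  apply (deriv_on_pow_bound a b M 2
    (fun t => F t - F a - (t - a) * f a - (t - a) ^ 2 / 2 * f1 a)
    (fun t => f t - f a - (t - a) * f1 a)); try lra; [deriv_on_tac|].
  apply (deriv_on_pow_bound a b M 1 _ (fun t => f1 t - f1 a)); try lra;
    [deriv_on_tac|].
  apply (deriv_on_pow_bound a b M 0 _ f2); try lra; [deriv_on_tac|].
  intros t Ht; rewrite pow_O, Rmult_1_r; auto.
Qed.

Lemma taylor_backward (a b M : R) (F f f1 f2 : R -> R) :
  a <= b -> deriv_on a b F f -> deriv_on a b f f1 -> deriv_on a b f1 f2 ->
  (forall t, a <= t <= b -> Rabs (f2 t) <= M) ->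
  Rabs (F b - F a - (b - a) * f b + (b - a) ^ 2 / 2 * f1 b) <= M * (b - a) ^ 3.
Proof.
  intros Hab D0 D1 D2 HM.
  assert (HM0 : 0 <= M) by (eapply Rle_trans; [apply Rabs_pos|apply (HM a); lra]).
  (* Expanding at the right end point makes the terms in [f] and [f1] cancel after a single
     differentiation. *)
  apply (deriv_on_pow_bound a b M 2
    (fun t => F t - F a - (t - a) * f t + (t - a) ^ 2 / 2 * f1 t)
    (fun t => (t - a) ^ 2 / 2 * f2 t)); try lra; [deriv_on_tac|].
  intros t Ht; specialize (HM t Ht).
  rewrite Rabs_mult, Rabs_pos_eq by (pose proof (pow2_ge_0 (t - a)); lra).
  pose proof (Rmult_le_compat_l _ _ _ (pow2_ge_0 (t - a)) HM).
  pose proof (Rmult_le_pos _ _ (pow2_ge_0 (t - a)) HM0); lra.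
Qed.

Lemma hermite_quadrature (a b M : R) (F f f1 f2 f3 f4 : R -> R) :
  a <= b -> deriv_on a b F f -> deriv_on a b f f1 -> deriv_on a b f1 f2 ->
  deriv_on a b f2 f3 -> deriv_on a b f3 f4 ->
  (forall t, a <= t <= b -> Rabs (f4 t) <= M) ->
  Rabs (F b - F a - (b - a) / 2 * (f a + f b) - (b - a) ^ 2 / 12 * (f1 a - f1 b))
    <= M * (b - a) ^ 5.
Proof.
  intros Hab D0 D1 D2 D3 D4 HM.
  assert (HM0 : 0 <= M) by (eapply Rle_trans; [apply Rabs_pos|apply (HM a); lra]).
  apply (deriv_on_pow_bound a b M 4
    (fun t => F t - F a - (t - a) / 2 * (f a + f t)
              - (t - a) ^ 2 / 12 * (f1 a - f1 t))
    (fun t => (f t - f a) / 2 - (t - a) / 2 * f1 t - (t - a) / 6 * (f1 a - f1 t)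
              + (t - a) ^ 2 / 12 * f2 t)); try lra; [deriv_on_tac|].
  apply (deriv_on_pow_bound a b M 3 _
    (fun t => (f1 t - f1 a) / 6 - (t - a) / 6 * f2 t + (t - a) ^ 2 / 12 * f3 t));
    try lra; [deriv_on_tac|].
  (* The weights 1/2 and 1/12 cancel every term below [f4] in the third derivative. Its factor
     [(t - a) ^ 2] and three integrations give the fifth power. *)
  apply (deriv_on_pow_bound a b M 2 _ (fun t => (t - a) ^ 2 / 12 * f4 t));
    try lra; [deriv_on_tac|].
  intros t Ht; specialize (HM t Ht).
  rewrite Rabs_mult, Rabs_pos_eq by (pose proof (pow2_ge_0 (t - a)); lra).
  pose proof (Rmult_le_compat_l _ _ _ (pow2_ge_0 (t - a)) HM).
  pose proof (Rmult_le_pos _ _ (pow2_ge_0 (t - a)) HM0); lra.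
Qed.

(** * Smooth functions of two variables and differentiation along the flow *)

Lemma smooth2_dy (f : R -> R -> R) : smooth2 f -> smooth2 (dy f).
Proof. intros H n y z; apply (H (S n) y z). Qed.

Lemma smooth2_dz (f : R -> R -> R) : smooth2 f -> smooth2 (dz f).
Proof. intros H n y z; apply (H (S n) y z). Qed.

Lemma smooth2_continuous (f : R -> R -> R) (p : R * R) :
  smooth2 f -> continuous (fun q : R * R => f (fst q) (snd q)) p.
Proof.
  intros H; destruct p as [y z].
  apply (proj1 (continuity_2d_pt_filterlim f y z)), (H 0%nat y z).
Qed.

(** Total differentiability follows from one partial derivative existing near the point and being
    continuous there, and the other existing at the point. *)
Lemma smooth2_differentiable (f : R -> R -> R) (y z : R) :
  smooth2 f -> differentiable_pt_lim f y z (dy f y z) (dz f y z).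
Proof.
  intros H; apply filterdiff_differentiable_pt_lim.
  apply (is_derive_filterdiff f y z (dy f) (dz f y z)).
  - apply filter_forall; intros [u v]; apply Derive_correct, (H 1%nat u v).
  - apply Derive_correct, (H 1%nat y z).
  - apply (smooth2_continuous (dy f) (y, z)), smooth2_dy, H.
Qed.

Lemma deriv_on_comp2 (a b : R) (f : R -> R -> R) (y y' z z' : R -> R) :
  smooth2 f -> deriv_on a b y y' -> deriv_on a b z z' ->
  deriv_on a b (fun t => f (y t) (z t))
    (fun t => dy f (y t) (z t) * y' t + dz f (y t) (z t) * z' t).
Proof.
  intros Hf [Cy Dy] [Cz Dz]; split.
  - intros t; apply continuous_comp_2; auto; apply (smooth2_continuous f (y t, z t) Hf).
  - intros t Ht; apply is_derive_Reals, derivable_pt_lim_comp_2d.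
    + apply smooth2_differentiable, Hf.
    + apply is_derive_Reals, Dy, Ht.
    + apply is_derive_Reals, Dz, Ht.
Qed.

(* A class of functions of time which is visibly stable under differentiation
   along the flow; it supplies the higher derivatives of the trajectory. *)
Inductive along (y z : R -> R) : (R -> R) -> Prop :=
| along_smooth f : smooth2 f -> along y z (fun t => f (y t) (z t))
| along_z : along y z z
| along_const k : along y z (fun _ => k)
| along_plus f h : along y z f -> along y z h -> along y z (fun t => f t + h t)
| along_mult f h : along y z f -> along y z h -> along y z (fun t => f t * h t).

(** By the chain rule a generator [f] yields [dy f * z + dz f * (/ eps * g)], whose factors are
    again generators; sums and products follow by induction. *)
Lemma along_deriv (g : R -> R -> R) (eps a b : R) (y z f : R -> R) :
  smooth2 g -> deriv_on a b y z ->
  deriv_on a b z (fun t => / eps * g (y t) (z t)) ->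
  along y z f -> exists f', along y z f' /\ deriv_on a b f f'.
Proof.
  intros Hg Dy Dz; induction 1 as [f Hf| |k|f h Hf [f' [Af Df]] Hh [h' [Ah Dh]]
                                  |f h Hf [f' [Af Df]] Hh [h' [Ah Dh]]].
  - eexists; split; [|apply (deriv_on_comp2 a b f y _ z _ Hf Dy Dz)].
    apply along_plus; apply along_mult.
    + apply (along_smooth y z (dy f)), smooth2_dy, Hf.
    + apply along_z.
    + apply (along_smooth y z (dz f)), smooth2_dz, Hf.
    + apply along_mult; [apply along_const|apply along_smooth, Hg].
  - eexists; split; [|apply Dz].
    apply along_mult; [apply along_const|apply along_smooth, Hg].
  - eexists; split; [apply along_const|apply deriv_on_const].
  - eexists; split; [|apply (deriv_on_plus a b f f' h h' Df Dh)].
    apply along_plus; assumption.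
  - eexists; split; [|apply (deriv_on_mult a b f f' h h' Df Dh)].
    apply along_plus; apply along_mult; assumption.
Qed.

(** * Compactness and extension beyond the time interval *)

Lemma continuous_bounded (a b : R) (f : R -> R) :
  a <= b -> (forall t, continuous f t) ->
  exists M, forall t, a <= t <= b -> Rabs (f t) <= M.
Proof.
  intros Hab Cf.
  destruct (continuity_ab_maj (fun t => Rabs (f t)) a b Hab) as [x [Hx _]].
  - intros t _; apply continuity_pt_filterlim.
    apply (continuous_comp f Rabs); [apply Cf|apply continuous_Rabs].
  - exists (Rabs (f x)); exact Hx.
Qed.

Definition clamp (T t : R) : R := Rmax 0 (Rmin T t).

Lemma clamp_in (T t : R) : 0 <= T -> 0 <= clamp T t <= T.
Proof.
  intros HT; unfold clamp; split; [apply Rmax_l|].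
  apply Rmax_lub; [exact HT|apply Rmin_l].
Qed.

Lemma clamp_id (T t : R) : 0 <= t <= T -> clamp T t = t.
Proof. intros Ht; unfold clamp; rewrite Rmin_right, Rmax_right; lra. Qed.

Lemma clamp_dist (T s t : R) : 0 <= T -> Rabs (clamp T s - clamp T t) <= Rabs (s - t).
Proof.
  intros HT; unfold clamp, Rmax, Rmin.
  repeat destruct Rle_dec; unfold Rabs; repeat destruct Rcase_abs; lra.
Qed.

(** The retraction [clamp T] is 1-Lipschitz into the interval, so continuity relative to the
    interval becomes continuity everywhere; at interior times it is locally the identity. *)
Lemma deriv_on_clamp (T : R) (f f' : R -> R) :
  0 < T ->
  (forall t, 0 <= t <= T -> is_derive_within (fun s => 0 <= s <= T) f t (f' t)) ->
  deriv_on 0 T (fun t => f (clamp T t)) (fun t => f' (clamp T t)).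
Proof.
  intros HT D; split.
  - intros t.
    apply (filterlim_comp _ _ _ (clamp T) f _
             (within (fun s => 0 <= s <= T) (locally (clamp T t)))).
    + intros P [d Hd]; exists d; intros s Hs.
      apply Hd; [|apply clamp_in; lra].
      apply Rle_lt_trans with (2 := Hs), clamp_dist; lra.
    + assert (Hc : 0 <= clamp T t <= T) by (apply clamp_in; lra).
      apply (filterdiff_continuous_aux f).
      * eexists; apply (D _ Hc).
      * intros P [e He]; exists e; intros s Hs _; apply He, Hs.
  - intros t Ht.
    assert (L : locally t (fun s => 0 <= s <= T)).
    { apply (locally_interval _ t 0 T); simpl; try lra; intros s H0 H1; simpl in *; lra. }
    rewrite clamp_id by lra.
    apply (is_derive_ext_loc f).
    { revert L; apply filter_imp; intros s Hs; rewrite clamp_id; auto. }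
    (* Limit points of [locally t] are limit points of its trace, and [L] removes the restriction to
       the interval from the resulting estimate. *)
    destruct (D t) as [Hl HD]; [lra|]; split; [exact Hl|].
    intros x Hx e.
    assert (Hx' : is_filter_lim (within (fun s => 0 <= s <= T) (locally t)) x).
    { intros P HP; destruct (Hx P HP) as [r Hr]; exists r; intros s Hs _; apply Hr, Hs. }
    generalize (filter_and _ _ L (HD x Hx' e)); apply filter_imp.
    intros s [H1 H2]; exact (H2 H1).
Qed.

(** * Defects of the exact solution *)

(** In order, these are the defects in the [y] and [z] equations of the predictor, then of the
    corrector. Compactness of the time interval bounds the higher derivatives, so one [M] serves all
    steps. *)
Lemma solution_residuals (g : R -> R -> R) (eps T y0 z0 : R) (y z : R -> R) :
  smooth2 g -> 0 < T -> exact_solution g eps T y0 z0 y z ->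
  exists M, forall a b, 0 <= a -> a <= b -> b <= T ->
    let g' t := / eps * g (y t) (z t) in
    let gd t := / eps * gdot g eps (y t) (z t) in
    Rabs (y b - y a - (b - a) * z a - (b - a) ^ 2 / 2 * g' a) <= M * (b - a) ^ 3 /\
    Rabs (z b - z a - (b - a) * g' b + (b - a) ^ 2 / 2 * gd b) <= M * (b - a) ^ 3 /\
    Rabs (y b - y a - (b - a) / 2 * (z a + z b) - (b - a) ^ 2 / 12 * (g' a - g' b))
      <= M * (b - a) ^ 5 /\
    Rabs (z b - z a - (b - a) / 2 * (g' a + g' b)
          - (b - a) ^ 2 / 12 * (gd a - gd b)) <= M * (b - a) ^ 5.
Proof.
  intros Hg HT [_ [_ Hsol]].
  set (yc := fun t => y (clamp T t)); set (zc := fun t => z (clamp T t)).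
  (* The index of [f2] to [f7] is the order of the derivative of [yc]. *)
  set (f2 := fun t => / eps * g (yc t) (zc t)).
  set (f3 := fun t => / eps * gdot g eps (yc t) (zc t)).
  assert (D0 : deriv_on 0 T yc zc) by (apply deriv_on_clamp; [exact HT|apply Hsol]).
  assert (D1 : deriv_on 0 T zc f2).
  { apply (deriv_on_clamp T z (fun t => / eps * g (y t) (z t))); [exact HT|apply Hsol]. }
  assert (D2 : deriv_on 0 T f2 f3).
  { eapply deriv_on_ext; [reflexivity| |].
    2:{ apply deriv_on_mult; [apply deriv_on_const|].
        apply (deriv_on_comp2 0 T g yc _ zc _ Hg D0 D1). }
    intros t; unfold f3, f2, gdot; ring. }
  assert (A3 : along yc zc f3).
  { apply along_mult; [apply along_const|].
    apply along_plus; apply along_mult; try apply along_mult.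
    - apply (along_smooth yc zc (dy g)), smooth2_dy, Hg.
    - apply along_z.
    - apply along_const.
    - apply (along_smooth yc zc (dz g)), smooth2_dz, Hg.
    - apply along_smooth, Hg. }
  destruct (along_deriv g eps 0 T yc zc f3 Hg D0 D1 A3) as [f4 [A4 D3]].
  destruct (along_deriv g eps 0 T yc zc f4 Hg D0 D1 A4) as [f5 [A5 D4]].
  destruct (along_deriv g eps 0 T yc zc f5 Hg D0 D1 A5) as [f6 [A6 D5]].
  (* Differentiating once more supplies the continuity of [f6], hence its bound. *)
  destruct (along_deriv g eps 0 T yc zc f6 Hg D0 D1 A6) as [f7 [_ D6]].
  destruct (continuous_bounded 0 T f2) as [M2 H2]; [lra|apply D2|].
  destruct (continuous_bounded 0 T f4) as [M4 H4]; [lra|apply D4|].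
  destruct (continuous_bounded 0 T f3) as [M3 H3]; [lra|apply D3|].
  destruct (continuous_bounded 0 T f5) as [M5 H5]; [lra|apply D5|].
  destruct (continuous_bounded 0 T f6) as [M6 H6]; [lra|apply D6|].
  set (M := Rabs M2 + Rabs M3 + Rabs M4 + Rabs M5 + Rabs M6).
  assert (HM : M2 <= M /\ M3 <= M /\ M4 <= M /\ M5 <= M /\ M6 <= M).
  { unfold M; pose proof (Rle_abs M2); pose proof (Rle_abs M3);
    pose proof (Rle_abs M4); pose proof (Rle_abs M5); pose proof (Rle_abs M6);
    pose proof (Rabs_pos M2); pose proof (Rabs_pos M3); pose proof (Rabs_pos M4);
    pose proof (Rabs_pos M5); pose proof (Rabs_pos M6); lra. }
  exists M; intros a b Ha Hab Hb; cbv zeta.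
  apply (deriv_on_sub 0 T a b) in D0, D1, D2, D3, D4, D5; try lra.
  assert (Ey : forall t, a <= t <= b -> yc t = y t /\ zc t = z t).
  { intros t Ht; unfold yc, zc; rewrite clamp_id by lra; auto. }
  destruct (Ey a) as [Eya Eza]; [lra|]; destruct (Ey b) as [Eyb Ezb]; [lra|].
  rewrite <- Eya, <- Eyb, <- Eza, <- Ezb.
  repeat split.
  - apply (taylor_forward a b M yc zc f2 f3); auto.
    intros t Ht; apply Rle_trans with M3; [apply H3|]; lra.
  - apply (taylor_backward a b M zc f2 f3 f4); auto.
    intros t Ht; apply Rle_trans with M4; [apply H4|]; lra.
  - apply (hermite_quadrature a b M yc zc f2 f3 f4 f5); auto.
    intros t Ht; apply Rle_trans with M5; [apply H5|]; lra.
  - apply (hermite_quadrature a b M zc f2 f3 f4 f5 f6); auto.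
    intros t Ht; apply Rle_trans with M6; [apply H6|]; lra.
Qed.

(** * Error bounds for one predictor and one corrector stage *)

Lemma norm_pair_le (a b : R) : norm (a, b) <= Rabs a + Rabs b.
Proof.
  pose proof (Rabs_pos a) as Ha; pose proof (Rabs_pos b) as Hb.
  change (sqrt (Rabs a ^ 2 + Rabs b ^ 2) <= Rabs a + Rabs b).
  rewrite <- (sqrt_pow2 (Rabs a + Rabs b)) by lra.
  apply sqrt_le_1_alt; nra.
Qed.

(** Errors are propagated in the sum norm, which keeps the estimates linear. [Rabs K] allows any
    sign of [K], and the slack up to [L] lets [g] and [gdot] share one constant. *)
Lemma lipschitz2_l1 (f : R -> R -> R) (K L : R) :
  lipschitz2 f K -> Rabs K <= L ->
  forall y1 z1 y2 z2,
    Rabs (f y1 z1 - f y2 z2) <= L * (Rabs (y1 - y2) + Rabs (z1 - z2)).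
Proof.
  intros Hf HK y1 z1 y2 z2; eapply Rle_trans; [apply Hf|].
  assert (H0 : 0 <= norm (y1 - y2, z1 - z2)) by apply norm_ge_0.
  pose proof (norm_pair_le (y1 - y2) (z1 - z2)); pose proof (Rle_abs K);
  pose proof (Rabs_pos K).
  apply Rle_trans with (L * norm (y1 - y2, z1 - z2)).
  - apply Rmult_le_compat_r; [exact H0|lra].
  - apply Rmult_le_compat_l; lra.
Qed.

Lemma Rabs_scal_le (k x u : R) : 0 <= k -> Rabs x <= u -> Rabs (k * x) <= k * u.
Proof.
  intros Hk Hx; rewrite Rabs_mult, Rabs_pos_eq by exact Hk.
  apply Rmult_le_compat_l; assumption.
Qed.

Lemma predictor_error (g : R -> R -> R) (eps L M h yn zn y1 z1 yk zk : R) :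
  0 < eps -> 0 <= L -> 0 < h -> h <= 1 -> 4 * (/ eps * L) * h <= 1 ->
  (forall y1 z1 y2 z2, Rabs (g y1 z1 - g y2 z2)
     <= L * (Rabs (y1 - y2) + Rabs (z1 - z2))) ->
  (forall y1 z1 y2 z2, Rabs (gdot g eps y1 z1 - gdot g eps y2 z2)
     <= L * (Rabs (y1 - y2) + Rabs (z1 - z2))) ->
  Rabs (y1 - yn - h * zn - h ^ 2 / 2 * (/ eps * g yn zn)) <= M * h ^ 3 ->
  Rabs (z1 - zn - h * (/ eps * g y1 z1) + h ^ 2 / 2 * (/ eps * gdot g eps y1 z1))
    <= M * h ^ 3 ->
  predictor g eps h yn zn yk zk ->
  Rabs (yk - y1) + Rabs (zk - z1) <= 4 * M * h ^ 3.
Proof.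
  intros Heps HL Hh Hh1 HhL Lg Ld Ry Rz [Py Pz].
  specialize (Lg yk zk y1 z1); specialize (Ld yk zk y1 z1).
  assert (Ha : 0 < / eps) by (apply Rinv_0_lt_compat, Heps).
  replace (h ^ 2 / (2 * eps)) with (h ^ 2 / 2 * / eps) in Py, Pz by (field; lra).
  replace (h / eps) with (h * / eps) in Pz by (field; lra).
  set (d := Rabs (yk - y1) + Rabs (zk - z1)) in *.
  assert (Hd : 0 <= d).
  { unfold d; pose proof (Rabs_pos (yk - y1)); pose proof (Rabs_pos (zk - z1)); lra. }
  set (a := / eps) in *; set (q := a * (L * d)).
  assert (Hq : 0 <= q) by (unfold q; repeat apply Rmult_le_pos; lra).
  assert (Hh2 : h ^ 2 <= h) by nra.
  pose proof (pow2_ge_0 h) as Hh20.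
  assert (Hhq : h ^ 2 * q <= h * q) by (apply Rmult_le_compat_r; assumption).
  (* This is the absorption: the implicit terms amount to at most [2 * (h * q)], hence [d / 2]. Then
     [d <= 2 * M * h ^ 3 + d / 2], which explains the factor 4. *)
  assert (Hqd : 4 * (h * q) <= d) by (unfold q; nra).
  apply (Rabs_scal_le a) in Lg, Ld; try lra; fold q in Lg, Ld.
  apply (Rabs_scal_le h) in Lg; [|lra].
  apply (Rabs_scal_le (h ^ 2)) in Ld; [|lra].
  assert (Ey : Rabs (yk - y1) <= M * h ^ 3).
  { rewrite Py, <- Rabs_Ropp; eapply Rle_trans; [|exact Ry]; right; f_equal; ring. }
  assert (Ez : Rabs (zk - z1) <= 2 * (h * q) + M * h ^ 3).
  { apply Rabs_le_between in Lg, Ld, Rz; apply Rabs_le_between; lra. }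
  unfold d in *; lra.
Qed.

(** The semi-implicit increments are differences between two stages, so they vanish at the exact
    solution and leave only the quadrature defect. Splitting them through [(y1, z1)] separates a
    multiple of [h] times the old error from a part absorbed by the new one. *)
Lemma corrector_error (g : R -> R -> R) (eps L M h yn zn y1 z1 yk zk yk1 zk1 : R) :
  0 < eps -> 0 <= L -> 0 < h -> h <= 1 -> 4 * (/ eps * L) * h <= 1 ->
  (forall y1 z1 y2 z2, Rabs (g y1 z1 - g y2 z2)
     <= L * (Rabs (y1 - y2) + Rabs (z1 - z2))) ->
  (forall y1 z1 y2 z2, Rabs (gdot g eps y1 z1 - gdot g eps y2 z2)
     <= L * (Rabs (y1 - y2) + Rabs (z1 - z2))) ->
  Rabs (y1 - yn - h / 2 * (zn + z1)
        - h ^ 2 / 12 * (/ eps * g yn zn - / eps * g y1 z1)) <= M * h ^ 5 ->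
  Rabs (z1 - zn - h / 2 * (/ eps * g yn zn + / eps * g y1 z1)
        - h ^ 2 / 12 * (/ eps * gdot g eps yn zn - / eps * gdot g eps y1 z1))
    <= M * h ^ 5 ->
  corrector g eps h yn zn yk zk yk1 zk1 ->
  Rabs (yk1 - y1) + Rabs (zk1 - z1)
    <= (2 + 10 * (/ eps * L)) * (h * (Rabs (yk - y1) + Rabs (zk - z1)))
       + 4 * M * h ^ 5.
Proof.
  intros Heps HL Hh Hh1 HhL Lg Ld Ry Rz [Py Pz].
  pose proof (Lg yk1 zk1 y1 z1) as Lg1; pose proof (Ld yk1 zk1 y1 z1) as Ld1.
  specialize (Lg yk zk y1 z1); specialize (Ld yk zk y1 z1).
  assert (Ha : 0 < / eps) by (apply Rinv_0_lt_compat, Heps).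
  replace (h ^ 2 / (2 * eps)) with (h ^ 2 / 2 * / eps) in Pz by (field; lra).
  replace (h ^ 2 / (12 * eps)) with (h ^ 2 / 12 * / eps) in Py, Pz by (field; lra).
  replace (h / (2 * eps)) with (h / 2 * / eps) in Pz by (field; lra).
  replace (h / eps) with (h * / eps) in Pz by (field; lra).
  assert (Hz : Rabs (zk - z1) <= Rabs (yk - y1) + Rabs (zk - z1)).
  { pose proof (Rabs_pos (yk - y1)); lra. }
  assert (Hd1 : 0 <= Rabs (yk1 - y1) + Rabs (zk1 - z1)).
  { pose proof (Rabs_pos (yk1 - y1)); pose proof (Rabs_pos (zk1 - z1)); lra. }
  assert (Hd : 0 <= Rabs (yk - y1) + Rabs (zk - z1)).
  { pose proof (Rabs_pos (yk - y1)); pose proof (Rabs_pos (zk - z1)); lra. }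
  set (d := Rabs (yk - y1) + Rabs (zk - z1)) in *.
  set (a := / eps) in *; set (q := a * (L * d)).
  set (q1 := a * (L * (Rabs (yk1 - y1) + Rabs (zk1 - z1)))).
  assert (Hq : 0 <= q) by (unfold q; repeat apply Rmult_le_pos; lra).
  assert (Hq1 : 0 <= q1) by (unfold q1; repeat apply Rmult_le_pos; lra).
  assert (Hh2 : h ^ 2 <= h) by nra.
  pose proof (pow2_ge_0 h) as Hh20.
  assert (Hhq : h ^ 2 * q <= h * q) by (apply Rmult_le_compat_r; assumption).
  assert (Hhq1 : h ^ 2 * q1 <= h * q1) by (apply Rmult_le_compat_r; assumption).
  assert (Hqd : 4 * (h * q1) <= Rabs (yk1 - y1) + Rabs (zk1 - z1)) by (unfold q1; nra).
  (* The two components will add up to [h * d + 5 * (h * q) + 2 * M * h ^ 5] plus [2 * (h * q1)].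
     The last term is at most half the new error, and absorbing it doubles the others. *)
  replace ((2 + 10 * (a * L)) * (h * d)) with (2 * (h * d) + 10 * (h * q))
    by (unfold q; ring).
  apply (Rabs_scal_le a) in Lg, Ld, Lg1, Ld1; try lra; fold q q1 in Lg, Ld, Lg1, Ld1.
  pose proof (Rabs_scal_le (h ^ 2) _ _ Hh20 Lg) as Lg2.
  apply (Rabs_scal_le h) in Lg, Lg1, Hz; try lra.
  apply (Rabs_scal_le (h ^ 2)) in Ld, Ld1; try lra.
  assert (0 <= h * q) by (apply Rmult_le_pos; lra).
  assert (Ey : Rabs (yk1 - y1) <= h * d + h * q + M * h ^ 5).
  { apply Rabs_le_between in Lg2, Hz, Ry; apply Rabs_le_between; lra. }
  assert (Ez : Rabs (zk1 - z1) <= 2 * (h * q1) + 4 * (h * q) + M * h ^ 5).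
  { apply Rabs_le_between in Lg, Ld, Lg1, Ld1, Rz; apply Rabs_le_between; lra. }
  lra.
Qed.

(** * Order gained per correction, and conclusion *)

Lemma pow_le_of_le1 (h : R) (m n : nat) : 0 <= h <= 1 -> (n <= m)%nat -> h ^ m <= h ^ n.
Proof.
  intros Hh Hmn; replace m with (n + (m - n))%nat by lia; rewrite pow_add.
  rewrite <- (Rmult_1_r (h ^ n)) at 2.
  apply Rmult_le_compat_l; [apply pow_le; lra|].
  rewrite <- (pow1 (m - n)); apply pow_incr; lra.
Qed.

(** Each correction gains one power of [h] until the quadrature term [h ^ 5] dominates, which is the
    cap at 4 in the minimum. [C] is chosen before [h] and [d], so the bound is uniform in the
    step. *)
Lemma order_recursion (K : R) (k : nat) :
  0 <= K ->
  exists C, 0 <= C /\ forall (h : R) (d : nat -> R),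
    0 < h <= 1 -> d 0%nat <= K * h ^ 3 ->
    (forall j, (j < k)%nat -> d (S j) <= K * (h * d j + h ^ 5)) ->
    d k <= C * h ^ (Nat.min 4 (2 + k) + 1).
Proof.
  intros HK; induction k as [|k [C [HC IH]]].
  - exists K; split; [exact HK|]; intros h d _ H0 _; exact H0.
  - exists (K * (C + 1)); split; [apply Rmult_le_pos; lra|].
    intros h d Hh H0 Hs.
    assert (Hk : d k <= C * h ^ (Nat.min 4 (2 + k) + 1)).
    { apply IH; auto. }
    eapply Rle_trans; [apply Hs; lia|].
    rewrite Rmult_assoc; apply Rmult_le_compat_l; [exact HK|].
    set (m := (Nat.min 4 (2 + S k) + 1)%nat).
    apply (Rmult_le_compat_l h) in Hk; [|lra].
    assert (H1 : h ^ S (Nat.min 4 (2 + k) + 1) <= h ^ m)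
      by (apply pow_le_of_le1; [lra|unfold m; lia]).
    assert (H5 : h ^ 5 <= h ^ m) by (apply pow_le_of_le1; [lra|unfold m; lia]).
    apply (Rmult_le_compat_l C) in H1; [|exact HC].
    rewrite <- tech_pow_Rmult in H1.
    set (x := h ^ (Nat.min 4 (2 + k) + 1)) in *; nra.
Qed.

Theorem theorem1 (g : R -> R -> R) (c Lg Lgdot eps T y0 z0 : R) (y z : R -> R)
  (Hsmooth : smooth2 g)
  (Hc : 0 < c)
  (Hdz : forall u v : R, dz g u v < - c)
  (Hg : lipschitz2 g Lg)
  (Heps : 0 < eps)
  (Hgdot : lipschitz2 (gdot g eps) (Lgdot / eps))
  (HT : 0 < T)
  (Hsol : exact_solution g eps T y0 z0 y z) :
  (forall k : nat,
     exists C dt0 : R, 0 < dt0 /\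
       forall (dt tn : R) (Y Z : nat -> R),
         0 < dt < dt0 -> 0 <= tn -> tn + dt <= T ->
         iterates g eps dt (y tn) (z tn) k Y Z ->
         error_at y z (tn + dt) (Y k) (Z k) <= C * dt ^ (Nat.min 4 (2 + k) + 1))
  /\
  (forall kmax : nat, (2 <= kmax)%nat ->
     consistent_of_order (method_step g eps kmax) T y z 4).
Proof.
  match goal with |- ?P /\ _ => assert (Main : P) end.
  { intros k.
    destruct (solution_residuals g eps T y0 z0 y z Hsmooth HT Hsol) as [M HM].
    set (L := Rabs Lg + Rabs (Lgdot / eps)).
    pose proof (Rabs_pos Lg) as HL1; pose proof (Rabs_pos (Lgdot / eps)) as HL2.
    assert (HL : 0 <= L) by (unfold L; lra).
    pose proof (lipschitz2_l1 g Lg L Hg ltac:(unfold L; lra)) as Lipg.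
    pose proof (lipschitz2_l1 (gdot g eps) _ L Hgdot ltac:(unfold L; lra)) as Lipd.
    assert (Ha : 0 < / eps) by (apply Rinv_0_lt_compat, Heps).
    set (A := / eps * L).
    assert (HA : 0 <= A) by (apply Rmult_le_pos; lra).
    (* One constant dominating [4 * M] from both stages and the factor [2 + 10 * A] of the
       corrector. *)
    set (K := 2 + 10 * A + 4 * Rabs M).
    pose proof (Rabs_pos M) as HM0; pose proof (Rle_abs M) as HM1.
    destruct (order_recursion K k) as [C [_ HC]]; [unfold K; lra|].
    assert (HD : 0 < / (4 * A + 1)) by (apply Rinv_0_lt_compat; lra).
    (* The bound 1 gives [h ^ 2 <= h]; the other gives [4 * A * h <= 1], with the added 1 covering
       [A = 0]. *)
    exists C, (Rmin 1 (/ (4 * A + 1))); split; [apply Rmin_glb_lt; lra|].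
    intros h tn Y Z [Hh0 Hh] Ht0 HtT [HP HCo].
    assert (Hh1 : h <= 1) by (pose proof (Rmin_l 1 (/ (4 * A + 1))); lra).
    assert (HAh : 4 * A * h <= 1).
    { assert (Hh2 : h <= / (4 * A + 1)) by (pose proof (Rmin_r 1 (/ (4 * A + 1))); lra).
      apply (Rmult_le_compat_l (4 * A + 1)) in Hh2; [|lra].
      rewrite Rinv_r in Hh2 by lra; lra. }
    specialize (HM tn (tn + h) Ht0 ltac:(lra) HtT); cbv zeta in HM.
    replace (tn + h - tn) with h in HM by ring.
    destruct HM as [R1 [R2 [R3 R4]]].
    set (d := fun j => Rabs (Y j - y (tn + h)) + Rabs (Z j - z (tn + h))).
    eapply Rle_trans; [apply norm_pair_le|]; apply (HC h d); [lra| |].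
    - pose proof (predictor_error g eps L M h _ _ _ _ _ _ Heps HL Hh0 Hh1 HAh
                    Lipg Lipd R1 R2 HP) as E.
      eapply Rle_trans; [exact E|].
      apply Rmult_le_compat_r; [apply pow_le; lra|unfold K; lra].
    - intros j Hj.
      pose proof (corrector_error g eps L M h _ _ _ _ _ _ _ _ Heps HL Hh0 Hh1 HAh
                    Lipg Lipd R3 R4 (HCo j Hj)) as E.
      eapply Rle_trans; [exact E|]; rewrite (Rmult_plus_distr_l K).
      apply Rplus_le_compat; apply Rmult_le_compat_r.
      + apply Rmult_le_pos; [lra|]; apply Rplus_le_le_0_compat; apply Rabs_pos.
      + unfold K; fold A; lra.
      + apply pow_le; lra.
      + unfold K; lra. }
  split; [exact Main|].
  intros kmax Hk; destruct (Main kmax) as [C [dt0 [Hdt0 HC]]].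
  (* From two corrections on the minimum is saturated, so the exponent is 5. *)
  replace (Nat.min 4 (2 + kmax)) with 4%nat in HC by lia.
  exists C, dt0; split; [exact Hdt0|].
  intros dt tn yn1 zn1 Hdt Ht0 HtT [Y [Z [HI [-> ->]]]].
  apply HC; assumption.
Qed.
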